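(* Let $K$ be a field, let $n\ge 3$ and $m\ge 2$ be integers with $n\ge m+1$, let $R$ be the full set of fully overlapped zero relations of the same fixed length $m$ on $\vec A_n$, i.e. $R$ is the set of all paths of length $m$ in $\vec A_n$, and let $A=K\vec A_n/\langle R\rangle$. (i) If $m=2$, then $\mathrm{dom.dim}\,A=n-1$. (ii) If $m\ge 3$, write $n\in m\mathbb N+j$ with $j\in\{1,2,\dots,m\}$, where $\mathbb N=\{1,2,3,\dots\}$. Then $$\mathrm{dom.dim}\,A=\begin{cases}\dfrac{2n-(m+2j)}{m}, & j=1,2,\dots,m-2,\\[2mm] \dfrac{2n-2j}{m}, & j=m-1,\\[2mm] \dfrac{2n-j}{m}, & j=m.\end{cases}$$
   Context: $\vec A_n$ denotes the linearly oriented quiver $1\to 2\to\cdots\to n$. A zero relation is a single path of length at least two which is set to zero; its length is its number of arrows. Modules are finite dimensional left modules. For a module $M$ and an integer $k\ge 1$, write $\mathrm{dom.dim}\,M\ge k$ if $M$ has a minimal injective resolution $0\to M\to I_1\to I_2\to\cdots$ such that $I_1,\dots,I_k$ are all projective (zero modules count as projective). If $I_1$ is not projective, $\mathrm{dom.dim}\,M=0$; if $\mathrm{dom.dim}\,M\ge k$ but not $\ge k+1$, then $\mathrm{dom.dim}\,M=k$; if no such finite $k$ exists, $\mathrm{dom.dim}\,M=\infty$. The dominant dimension of an algebra $A$ is $\mathrm{dom.dim}\,A:=\mathrm{dom.dim}({}_AA)$. *)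

(* Defs.v *)
From HB Require Import structures.
From mathcomp Require Import all_boot all_order all_algebra.
From mathcomp Require Import boolp classical_sets.

Set Implicit Arguments.
Unset Strict Implicit.
Unset Printing Implicit Defensive.

Import GRing.Theory.

Local Open Scope classical_set_scope.
Local Open Scope ring_scope.

Section QuotientAlgebra.
Variables (K : fieldType) (B : algType K).

Definition is_ideal (J : set B) : Prop :=
  [/\ J 0, forall x y, J x -> J y -> J (x - y),
      forall a x, J x -> J (a * x) & forall a x, J x -> J (x * a)].

Variable S : set B.

Definition gen_ideal : {pred B} :=
  fun x => `[< forall J : set B, is_ideal J -> S `<=` J -> J x >].

Lemma gen_idealP x : reflect
  (forall J : set B, is_ideal J -> S `<=` J -> J x) (x \in gen_ideal).
Proof. exact: asboolP. Qed.

Lemma gen_ideal_zmod : zmod_closed gen_ideal.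
Proof.
split=> [|x y /gen_idealP Hx /gen_idealP Hy]; apply/gen_idealP => J HJ SJ.
  by case: HJ.
by case: (HJ) => _ HB _ _; apply: HB; [exact: Hx | exact: Hy].
Qed.

HB.instance Definition _ := GRing.isZmodClosed.Build B gen_ideal gen_ideal_zmod.

Lemma gen_idealMl a x : x \in gen_ideal -> a * x \in gen_ideal.
Proof.
move=> /gen_idealP Hx; apply/gen_idealP => J HJ SJ.
by case: (HJ) => _ _ H _; apply: H; exact: Hx.
Qed.

Lemma gen_idealMr a x : x \in gen_ideal -> x * a \in gen_ideal.
Proof.
move=> /gen_idealP Hx; apply/gen_idealP => J HJ SJ.
by case: (HJ) => _ _ _ H; apply: H; exact: Hx.
Qed.

Lemma gen_idealZ (c : K) x : x \in gen_ideal -> c *: x \in gen_ideal.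
Proof. by move=> Hx; rewrite -[x]mul1r scalerAl; exact: gen_idealMl. Qed.

(* A ring of type [algType K] must be nonzero, so quotients are only taken by
   proper ideals. *)
Hypothesis properS : 1 \notin gen_ideal.

Definition quotAlg of 1 \notin gen_ideal : Type := Quotient.quot gen_ideal.
Local Notation Q := (quotAlg properS).

HB.instance Definition _ := GRing.Zmodule.on Q.

Definition quot_proj (x : B) : Q := (\pi_(Quotient.quot gen_ideal) x)%qT.
Definition quot_repr (x : Q) : B := repr (x : Quotient.quot gen_ideal).

Lemma quot_reprK : cancel quot_repr quot_proj.
Proof. exact: reprK. Qed.

Lemma quot_projE x y : (quot_proj x = quot_proj y) <-> (x - y \in gen_ideal).
Proof. by rewrite Quotient.idealrBE; split=> [H|/eqP //]; apply/eqP. Qed.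

Lemma quot_projD x y : quot_proj (x + y) = quot_proj x + quot_proj y.
Proof. exact: Quotient.pi_add. Qed.

Lemma quot_proj0 : quot_proj 0 = 0.
Proof. by apply: (addIr (quot_proj 0)); rewrite add0r -quot_projD addr0. Qed.

Definition quot_one : Q := quot_proj 1.
Definition quot_mul (x y : Q) : Q :=
  quot_proj (quot_repr x * quot_repr y).
Definition quot_scale (c : K) (x : Q) : Q :=
  quot_proj (c *: quot_repr x).

Lemma quot_projM x y : quot_mul (quot_proj x) (quot_proj y) = quot_proj (x * y).
Proof.
rewrite /quot_mul; apply/quot_projE.
set x' := quot_repr _; set y' := quot_repr _.
have Hx : x' - x \in gen_ideal by apply/quot_projE; exact: quot_reprK.
have Hy : y' - y \in gen_ideal by apply/quot_projE; exact: quot_reprK.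
have -> : x' * y' - x * y = x' * (y' - y) + (x' - x) * y.
  by rewrite mulrBr mulrBl addrA subrK.
by apply: rpredD; [exact: gen_idealMl | exact: gen_idealMr].
Qed.

Lemma quot_projZ c x : quot_scale c (quot_proj x) = quot_proj (c *: x).
Proof.
rewrite /quot_scale; apply/quot_projE; rewrite -scalerBr; apply: gen_idealZ.
by apply/quot_projE; exact: quot_reprK.
Qed.

Lemma quot_mulA : associative quot_mul.
Proof.
move=> x y z; rewrite -[x]quot_reprK -[y]quot_reprK -[z]quot_reprK.
by rewrite !quot_projM mulrA.
Qed.

Lemma quot_mul1r : left_id quot_one quot_mul.
Proof. by move=> x; rewrite -[x]quot_reprK quot_projM mul1r. Qed.

Lemma quot_mulr1 : right_id quot_one quot_mul.
Proof. by move=> x; rewrite -[x]quot_reprK quot_projM mulr1. Qed.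

Lemma quot_mulDl : left_distributive quot_mul +%R.
Proof.
move=> x y z; rewrite -[x]quot_reprK -[y]quot_reprK -[z]quot_reprK.
by rewrite -quot_projD !quot_projM mulrDl quot_projD.
Qed.

Lemma quot_mulDr : right_distributive quot_mul +%R.
Proof.
move=> x y z; rewrite -[x]quot_reprK -[y]quot_reprK -[z]quot_reprK.
by rewrite -quot_projD !quot_projM mulrDr quot_projD.
Qed.

Lemma quot_oner_neq0 : quot_one != 0.
Proof.
rewrite -quot_proj0; apply/eqP => /quot_projE; rewrite subr0.
by apply/negP; exact: properS.
Qed.

HB.instance Definition _ := GRing.Zmodule_isNzRing.Build Q
  quot_mulA quot_mul1r quot_mulr1 quot_mulDl quot_mulDr quot_oner_neq0.

Lemma quot_scalerA a b x : quot_scale a (quot_scale b x) = quot_scale (a * b) x.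
Proof. by rewrite -[x]quot_reprK !quot_projZ scalerA. Qed.

Lemma quot_scale1r : left_id 1 quot_scale.
Proof. by move=> x; rewrite -[x]quot_reprK quot_projZ scale1r. Qed.

Lemma quot_scalerDr : right_distributive quot_scale +%R.
Proof.
move=> c x y; rewrite -[x]quot_reprK -[y]quot_reprK.
by rewrite -quot_projD !quot_projZ scalerDr quot_projD.
Qed.

Lemma quot_scalerDl x : {morph quot_scale^~ x : a b / a + b}.
Proof.
by move=> a b; rewrite -[x]quot_reprK !quot_projZ scalerDl quot_projD.
Qed.

HB.instance Definition _ := GRing.Zmodule_isLmodule.Build K Q
  quot_scalerA quot_scale1r quot_scalerDr quot_scalerDl.

Lemma quot_scalerAl (c : K) (x y : Q) : c *: (x * y) = (c *: x) * y.
Proof.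
change (quot_scale c (quot_mul x y) = quot_mul (quot_scale c x) y).
rewrite -[x]quot_reprK -[y]quot_reprK.
by rewrite quot_projZ !quot_projM quot_projZ scalerAl.
Qed.

Lemma quot_scalerAr (c : K) (x y : Q) : c *: (x * y) = x * (c *: y).
Proof.
change (quot_scale c (quot_mul x y) = quot_mul x (quot_scale c y)).
rewrite -[x]quot_reprK -[y]quot_reprK.
by rewrite quot_projZ !quot_projM quot_projZ scalerAr.
Qed.

HB.instance Definition _ := GRing.Lmodule_isLalgebra.Build K Q quot_scalerAl.
HB.instance Definition _ := GRing.Lalgebra_isAlgebra.Build K Q quot_scalerAr.

End QuotientAlgebra.

(* The vertices are 0, ..., n - 1.  For i <= j there is exactly one path from i
   to j (the trivial path when i = j), and otherwise none; so a path is encoded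
   by its source and its target. *)
Definition lpath (n : nat) : Type := {p : 'I_n * 'I_n | (p.1 <= p.2)%N}.
HB.instance Definition _ n := Finite.on (lpath n).

Section Paths.
Variable n : nat.
Implicit Types p q r : lpath n.

Definition psrc p : 'I_n := (val p).1.
Definition ptgt p : 'I_n := (val p).2.
Definition plen p : nat := (ptgt p - psrc p)%N.

(* p is the composite path "first r, then q" *)
Definition is_comp q r p : bool :=
  [&& ptgt r == psrc q, psrc p == psrc r & ptgt p == ptgt q].

Lemma psrc_le p : (psrc p <= ptgt p)%N.
Proof. exact: (valP p). Qed.

Lemma lpathP p q : psrc p = psrc q -> ptgt p = ptgt q -> p = q.
Proof.
by rewrite /psrc /ptgt => H1 H2; apply: val_inj; apply: injective_projections.
Qed.

Definition triv_path (i : 'I_n) : lpath n := Sub (i, i) (leqnn i).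

Lemma lpath_ex (i j : 'I_n) : (i <= j)%N ->
  exists2 p : lpath n, psrc p = i & ptgt p = j.
Proof. by move=> ij; exists (Sub (i, j) ij). Qed.

End Paths.

Section PathAlgebra.
(* As n.-1.+1 = n for n > 0, this is the path algebra of the quiver with n
   vertices; the case n = 0, which would give the zero ring, is discarded. *)
Variables (K : fieldType) (n : nat).
Local Notation path := (lpath n.-1.+1).
Implicit Types p q r : path.

Definition pathAlg : Type := {ffun path -> K}.
HB.instance Definition _ := GRing.Lmodule.copy pathAlg {ffun path -> K^o}.

Definition path_elt p : pathAlg := [ffun q => (q == p)%:R].

Definition path_one : pathAlg := [ffun p => (psrc p == ptgt p)%:R].

(* Paths are composed like functions: the product q * r is "first r, then q"
   when this makes sense and 0 otherwise, so that left modules are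
   (covariant) representations of the quiver. *)
Definition path_mul (f g : pathAlg) : pathAlg :=
  [ffun p => \sum_q \sum_(r | is_comp q r p) f q * g r].

Lemma path_mulDl : left_distributive path_mul +%R.
Proof.
move=> f g h; apply/ffunP => p; rewrite !ffunE -big_split; apply: eq_bigr => q _.
by rewrite -big_split; apply: eq_bigr => r _; rewrite ffunE mulrDl.
Qed.

Lemma path_mulDr : right_distributive path_mul +%R.
Proof.
move=> f g h; apply/ffunP => p; rewrite !ffunE -big_split; apply: eq_bigr => q _.
by rewrite -big_split; apply: eq_bigr => r _; rewrite ffunE mulrDr.
Qed.

Lemma path_mul1r : left_id path_one path_mul.
Proof.
move=> f; apply/ffunP => p; rewrite ffunE (bigD1 (triv_path (ptgt p))) //=.
rewrite (bigD1 p) /=; last by rewrite /is_comp /= !eqxx.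
rewrite ffunE eqxx mul1r !big1 ?addr0 // => [q Hq|r].
  rewrite big1 // => r /and3P [/eqP H1 /eqP H2 /eqP H3].
  rewrite ffunE; case: eqP => [E|_]; last by rewrite mul0r.
  by case/eqP: Hq; apply: lpathP; rewrite /= -?E ?H3 ?E.
case/andP => /and3P [/eqP H1 /eqP H2 /eqP H3] /eqP [].
exact: lpathP.
Qed.

Lemma path_mulr1 : right_id path_one path_mul.
Proof.
move=> f; apply/ffunP => p; rewrite ffunE (bigD1 p) //=.
rewrite (bigD1 (triv_path (psrc p))) /=; last by rewrite /is_comp /= !eqxx.
rewrite ffunE eqxx mulr1 !big1 ?addr0 // => [q Hq|r].
  rewrite big1 // => r /and3P [/eqP H1 /eqP H2 /eqP H3].
  rewrite ffunE; case: eqP => [E|_]; last by rewrite mulr0.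
  by case/eqP: Hq; apply: lpathP => //; rewrite -H1 -E.
case/andP => /and3P [/eqP H1 /eqP H2 /eqP H3] Hr.
rewrite ffunE; case: eqP => [E|_]; last by rewrite mulr0.
by case/eqP: Hr; apply: lpathP; rewrite /= -?E ?H2.
Qed.

Definition is_comp3 p1 p2 p3 p : bool :=
  [&& ptgt p3 == psrc p2, ptgt p2 == psrc p1, psrc p == psrc p3
    & ptgt p == ptgt p1].

Lemma path_mul_mulr f g h p : path_mul f (path_mul g h) p =
  \sum_p1 \sum_p2 \sum_(p3 | is_comp3 p1 p2 p3 p) f p1 * g p2 * h p3.
Proof.
rewrite ffunE; apply: eq_bigr => p1 _.
under eq_bigr => r _ do rewrite ffunE mulr_sumr.
rewrite exchange_big; apply: eq_bigr => p2 _ /=.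
under eq_bigr => r _ do rewrite mulr_sumr.
rewrite (exchange_big_dep (is_comp3 p1 p2 ^~ p)) /=.
  apply: eq_bigr => p3 /and4P [/eqP H1 /eqP H2 /eqP H3 /eqP H4].
  have [|r Hs Ht] := @lpath_ex _ (psrc p3) (ptgt p2).
    by rewrite (leq_trans (psrc_le p3)) // H1 psrc_le.
  rewrite (big_pred1 r) ?mulrA // => r' /=; rewrite /is_comp.
  apply/idP/eqP => [/andP [_ /and3P [_ /eqP E1 /eqP E2]]|->].
    by apply: lpathP; rewrite ?Hs ?Ht.
  by rewrite Hs Ht H1 H2 H3 H4 !eqxx.
move=> r p3 /and3P [/eqP H1 /eqP H2 /eqP H3] /and3P [/eqP H4 /eqP H5 /eqP H6].
by rewrite /is_comp3 H4 -H6 H1 H2 H5 H3 !eqxx.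
Qed.

Lemma path_mul_mull f g h p : path_mul (path_mul f g) h p =
  \sum_p1 \sum_p2 \sum_(p3 | is_comp3 p1 p2 p3 p) f p1 * g p2 * h p3.
Proof.
transitivity (\sum_q \sum_p3 \sum_p1 \sum_p2
    if is_comp q p3 p && is_comp p1 p2 q then f p1 * g p2 * h p3 else 0).
  rewrite ffunE; apply: eq_bigr => q _; rewrite big_mkcond; apply: eq_bigr => p3 _.
  case: ifP => _ /=; last by rewrite big1 // => p1 _; rewrite big1.
  rewrite ffunE mulr_suml; apply: eq_bigr => p1 _.
  by rewrite mulr_suml [LHS]big_mkcond.
under eq_bigr => q _ do rewrite exchange_big.
rewrite exchange_big; apply: eq_bigr => p1 _ /=.
under eq_bigr => q _ do rewrite exchange_big.
rewrite exchange_big; apply: eq_bigr => p2 _ /=.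
rewrite exchange_big [RHS]big_mkcond; apply: eq_bigr => p3 _ /=.
case: ifPn => [/and4P [/eqP H1 /eqP H2 /eqP H3 /eqP H4]|Hn].
  have [|r Hs Ht] := @lpath_ex _ (psrc p2) (ptgt p1).
    by rewrite (leq_trans (psrc_le p2)) // H2 psrc_le.
  rewrite (bigD1 r) //= big1 => [|q Hq].
    by rewrite /is_comp Hs Ht H1 H2 H3 H4 !eqxx addr0.
  case: ifP => // /andP [_ /and3P [_ /eqP E1 /eqP E2]].
  by case/eqP: Hq; apply: lpathP; rewrite ?Hs ?Ht.
rewrite big1 // => q _; case: ifP => //.
move=> /andP [/and3P [/eqP E1 /eqP E2 /eqP E3] /and3P [/eqP E4 /eqP E5 /eqP E6]].
by case/negP: Hn; rewrite /is_comp3 E1 E2 E3 E4 E5 E6 !eqxx.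
Qed.

Lemma path_mulA : associative path_mul.
Proof.
by move=> f g h; apply/ffunP => p; rewrite path_mul_mulr path_mul_mull.
Qed.

Lemma path_oner_neq0 : path_one != 0.
Proof.
apply/eqP => /ffunP /(_ (triv_path ord0)).
by rewrite !ffunE eqxx => /eqP; rewrite oner_eq0.
Qed.

HB.instance Definition _ := GRing.Zmodule_isNzRing.Build pathAlg
  path_mulA path_mul1r path_mulr1 path_mulDl path_mulDr path_oner_neq0.

Lemma path_scalerAl (c : K) (f g : pathAlg) : c *: (f * g) = (c *: f) * g.
Proof.
apply/ffunP => p; rewrite !ffunE scaler_sumr; apply: eq_bigr => q _.
by rewrite scaler_sumr; apply: eq_bigr => r _; rewrite ffunE scalerAl.
Qed.

Lemma path_scalerAr (c : K) (f g : pathAlg) : c *: (f * g) = f * (c *: g).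
Proof.
apply/ffunP => p; rewrite !ffunE scaler_sumr; apply: eq_bigr => q _.
by rewrite scaler_sumr; apply: eq_bigr => r _; rewrite ffunE scalerAr.
Qed.

HB.instance Definition _ :=
  GRing.Lmodule_isLalgebra.Build K pathAlg path_scalerAl.
HB.instance Definition _ :=
  GRing.Lalgebra_isAlgebra.Build K pathAlg path_scalerAr.

Definition zero_relations (m : nat) : set pathAlg :=
  [set f | exists2 p, plen p = m & f = path_elt p].

Lemma zero_relations_proper m : (2 <= m)%N ->
  1 \notin gen_ideal (zero_relations m).
Proof.
move=> m_ge2; apply/negP => /gen_idealP.
pose J : set pathAlg := fun f => forall i, f (triv_path i) = 0.
suff [HJ SJ] : is_ideal J /\ zero_relations m `<=` J.
  move=> /(_ J HJ SJ ord0); rewrite ffunE eqxx.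
  by apply/eqP; exact: oner_neq0.
split; last first.
  move=> _ [p Hp ->] i; rewrite ffunE; case: eqP => // E.
  by move: m_ge2; rewrite -Hp -E /plen subnn.
split=> [i|f g Hf Hg i|a f Hf i|a f Hf i]; rewrite !ffunE ?Hf ?Hg ?subr0 //.
  rewrite big1 // => q _; rewrite big1 // => r.
  move=> /and3P [/eqP H1 /eqP H2 /eqP H3].
  suff -> : r = triv_path (psrc r) by rewrite Hf mulr0.
  apply: lpathP => //; apply/val_inj/eqP; rewrite eqn_leq psrc_le andbT.
  by rewrite H1 -H2 (leq_trans (psrc_le q)) // -H3.
rewrite big1 // => q _; rewrite big1 // => r.
move=> /and3P [/eqP H1 /eqP H2 /eqP H3].
suff -> : q = triv_path (psrc q) by rewrite Hf mul0r.
apply: lpathP => //; apply/val_inj/eqP; rewrite eqn_leq psrc_le andbT.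
by rewrite -H3 -H1 (leq_trans _ (psrc_le r)) // -H2.
Qed.

(* K A_n / <R>, where R is the set of all paths of length m *)
Definition truncPathAlg (m : nat) (m_ge2 : (2 <= m)%N) : algType K :=
  quotAlg (zero_relations_proper m_ge2).

End PathAlgebra.

Section DominantDimension.
Variables (K : fieldType) (A : algType K).
Implicit Types (M X Y I P : lmodType A).

(* Finite dimensional over K, which acts through c |-> c *: 1. *)
Definition fin_dim M : Prop :=
  exists s : seq M, forall x : M, exists c : 'I_(size s) -> K,
    x = \sum_i ((c i)%:A : A) *: s`_i.

Definition injective_module I : Prop :=
  fin_dim I /\
  forall X Y, fin_dim X -> fin_dim Y ->
  forall (u : {linear X -> Y}) (f : {linear X -> I}), injective u ->
  exists g : {linear Y -> I}, forall x, g (u x) = f x.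

Definition projective_module P : Prop :=
  fin_dim P /\
  forall X Y, fin_dim X -> fin_dim Y ->
  forall (u : {linear X -> Y}) (f : {linear P -> Y}), (forall y, exists x, u x = y) ->
  exists g : {linear P -> X}, forall x, u (g x) = f x.

Definition is_submodule M (N : set M) : Prop :=
  [/\ N 0, forall x y, N x -> N y -> N (x + y) & forall (a : A) x, N x -> N (a *: x)].

Definition essential M (N : set M) : Prop :=
  forall N' : set M, is_submodule N' -> (exists2 x, N' x & x <> 0) ->
  exists x, [/\ N x, N' x & x <> 0].

(* [I k] is the term I_(k+1) of 0 -> M -> I_1 -> I_2 -> ...; minimality says
   that each term is an injective envelope of the image of the preceding
   one, i.e. that this image is essential in it. *)
Definition min_injective_resolution M (I : nat -> lmodType A)
    (e : {linear M -> I 0%N}) (d : forall k, {linear I k -> I k.+1}) : Prop :=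
  [/\ forall k, injective_module (I k),
      injective e,
      forall x, d 0%N x = 0 <-> range e x,
      forall k x, d k.+1 x = 0 <-> range (d k) x
    & essential (range e) /\ forall k, essential (range (d k))].

Definition dom_dim_ge M (k : nat) : Prop :=
  exists (I : nat -> lmodType A) (e : {linear M -> I 0%N})
    (d : forall i, {linear I i -> I i.+1}),
    min_injective_resolution e d /\
    forall i, (i < k)%N -> projective_module (I i).

Definition dom_dim_eq M (k : nat) : Prop :=
  dom_dim_ge M k /\ ~ dom_dim_ge M k.+1.

(* [None] stands for infinity *)
Definition dom_dim M : option nat :=
  if pselect (exists k, dom_dim_eq M k) is left ex_k
  then Some (projT1 (cid ex_k)) else None.

End DominantDimension.

Definition alg_dom_dim (K : fieldType) (A : algType K) : option nat :=
  dom_dim (A^o : lmodType A).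

(* Main.v *)
From HB Require Import structures.
Require Import Defs.
From mathcomp Require Import all_boot all_order all_algebra.
From mathcomp Require Import boolp classical_sets zify ring.

(** Number the vertices 0, ..., n - 1.  An element of A is given by its
coefficients along the paths i -> j with i <= j < i + m, and these multiply like
the entries of triangular matrices supported in a band of width m.  The
indecomposable A-modules are the interval modules; for x <= n let I(x) be the
one living on the vertices i with i < x <= i + m.  It is the injective envelope
of the simple module at x - 1, because a linear map into it is the same as a
linear functional on the space at vertex x - 1 ([extend_to_sumMod]); I(0) is
zero.  When x >= m, it is also the projective module generated by its top
x - m ([projective_sumMod]), whereas for 0 < x < m it is a proper quotient of a
longer interval module with the same top, so that it is not projective
([not_projective_short]).

The indecomposable projective P_t starting at t is I(t + m) when t + m <= n.
Otherwise it is the interval from t to n - 1, and its minimal injective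
resolution is periodic up to a shift by m:

  0 -> P_t -> I(n) -> I(t) -> I(n - m) -> I(t - m) -> I(n - 2m) -> ...

where every map is the identity on the common vertices ([regular_resolution]).
Consecutive parameters differ by less than m, so the first parameter that drops
below m is still positive, and there projectivity fails for the first time.
The number of parameters that are at least m is floor(n/m) + floor(t/m); it is
smallest for t = n - m + 1.  Taking the sum over all t, one finds that the terms
of the resolution of A are projective exactly up to that index.

The definition of the dominant dimension lets one choose the minimal injective
resolution, so the upper bound also needs that any two of them have isomorphic
terms ([min_injective_resolution_iso]).  Hence, uniformly in m,

  dom.dim A = floor(n/m) + floor((n - m + 1)/m),

and the cases of the theorem are the values of this expression. *)

Set Implicit Arguments.
Unset Strict Implicit.
Unset Printing Implicit Defensive.

Import GRing.Theory.
Local Open Scope ring_scope.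

(** * Extending linear functionals *)

Section LinearAlgebra.
Variables (K : fieldType) (A : algType K).
Implicit Types X Y V : lmodType A.

Definition mk_linear X Y (f : X -> Y) (fL : linear f) : {linear X -> Y} :=
  HB.pack f (GRing.isLinear.Build _ _ _ _ f fL).

Lemma fin_dim_fin V (I : finType) (b : I -> V) (c : V -> I -> K) :
  (forall x, x = \sum_i ((c x i)%:A : A) *: b i) -> fin_dim V.
Proof.
move=> xE; exists [seq b i | i <- enum I] => x.
have szE : size [seq b i | i <- enum I] = #|I| by rewrite size_map cardE.
exists (fun k => c x (enum_val (cast_ord szE k))).
rewrite {1}[x]xE big_enum_val /=.
rewrite (reindex (cast_ord szE)) /=; last first.
  by exists (cast_ord (esym szE)) => k _; rewrite ?cast_ordK ?cast_ordKV.
apply: eq_bigr => k _; congr (_ *: _).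
set v := enum_val _; rewrite (nth_map v) -?cardE -?szE ?ltn_ord //.
by congr b; exact: enum_val_nth.
Qed.

(** The field acts on an A-module through scalars c%:A, so subspaces and
functionals are phrased with this action; no K-module structure is put on V. *)
Definition subspace V (W : set V) : Prop :=
  W 0 /\ forall (c : K) x y, W x -> W y -> W ((c%:A : A) *: x + y).

Definition functional_on V (W : set V) (phi : V -> K) : Prop :=
  forall (c : K) x y, W x -> W y -> phi ((c%:A : A) *: x + y) = c * phi x + phi y.

Lemma extend_functional1 V (W : set V) phi (v : V) :
  subspace W -> functional_on W phi ->
  exists W' psi, [/\ subspace W', functional_on W' psi, W' v
    & forall w, W w -> W' w /\ psi w = phi w].
Proof.
move=> WS phiL; have [Wv|nWv] := pselect (W v).
  by exists W, phi; split.
have [W0 WL] := WS.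
pose dec y (p : V * K) := W p.1 /\ y = p.1 + (p.2%:A : A) *: v.
(* As v lies outside W, the W-component of an element of W + K v is unique. *)
have dec_inj w w' c c' : W w -> W w' ->
    w + (c%:A : A) *: v = w' + (c'%:A : A) *: v -> w = w'.
  move=> Ww Ww' E; have [cc|ncc] := eqVneq c c'.
    by move: E; rewrite cc => /addIr.
  case: nWv; have Wd : W (w' - w).
    rewrite addrC -scaleN1r; have := WL (- 1) w w' Ww Ww'.
    by rewrite !scaleN1r.
  have -> : v = (((c - c')^-1)%:A : A) *: (w' - w) + 0.
    have -> : w' - w = ((c - c')%:A : A) *: v.
      apply/eqP; rewrite subr_eq scalerBl scalerBl addrAC eq_sym subr_eq.
      by rewrite addrC E addrC.
    by rewrite scalerA -scalerAl mul1r scalerA mulVf ?subr_eq0 // !scale1r addr0.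
  exact: WL.
pose W' : set V := fun y => exists p, dec y p.
pose psi y := if pselect (W' y) is left ex then phi (projT1 (cid ex)).1 else 0.
have psiE w c : W w -> psi (w + (c%:A : A) *: v) = phi w.
  move=> Ww; rewrite /psi; case: pselect => [ex|[]]; last by exists (w, c).
  case: cid => -[w' c'] [/= Ww' E]; congr phi; exact/esym/(dec_inj _ _ _ _ Ww Ww' E).
have comb (c : K) w w' d d' :
    (c%:A : A) *: (w + (d%:A : A) *: v) + (w' + (d'%:A : A) *: v) = ((c%:A : A) *: w + w') + ((c * d + d')%:A : A) *: v.
  rewrite scalerDr addrACA; congr (_ + _).
  by rewrite !scalerA -scalerDl -scalerAl mul1r scalerA -scalerDl.
exists W', psi; split=> //.
- split; first by exists (0, 0); split; rewrite //= scale0r scale0r addr0.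
  move=> c _ _ [[w d] [/= Ww ->]] [[w' d'] [/= Ww' ->]].
  by exists ((c%:A : A) *: w + w', c * d + d'); split; [exact: WL | exact: comb].
- move=> c _ _ [[w d] [/= Ww ->]] [[w' d'] [/= Ww' ->]].
  by rewrite comb !psiE ?phiL //; exact: WL.
- by exists (0, 1); split; rewrite //= scale1r scale1r add0r.
- move=> w Ww; have wE : w = w + (0%:A : A) *: v by rewrite scale0r scale0r addr0.
  split; first by exists (w, 0); split.
  by rewrite {1}wE psiE.
Qed.

Lemma extend_functional V (W : set V) phi : fin_dim V ->
  subspace W -> functional_on W phi ->
  exists psi, functional_on setT psi /\ forall w, W w -> psi w = phi w.
Proof.
move=> [s sP] WS phiL.
have [W' [psi [W'S psiL sW' Wpsi]]] : exists W' psi,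
    [/\ subspace W', functional_on W' psi, forall i, W' s`_i
      & forall w, W w -> W' w /\ psi w = phi w].
  elim: s {sP} => [|v s [W1 [psi1 [W1S psi1L sW1 WW1]]]].
    by exists W, phi; split=> // i; rewrite nth_nil; case: WS.
  have [W2 [psi2 [W2S psi2L vW2 W12]]] := extend_functional1 v W1S psi1L.
  exists W2, psi2; split=> //; first by case=> // i; exact: (W12 _ (sW1 i)).1.
  by move=> w /WW1 [W1w <-]; exact: W12.
have W'T y : W' y.
  have [c ->] := sP y; have [W'0 W'L] := W'S.
  elim/big_rec: _ => // i z _ W'z; exact: W'L.
exists psi; split=> [c x y _ _|w /Wpsi [] //]; exact: psiL.
Qed.

(** A functional that kills ker u descends to the image of u and then extends
to Y.  For non-injective u, this spares forming the image as a module. *)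
Lemma factor_functional X Y (u : {linear X -> Y}) (phi : X -> K) :
  fin_dim Y -> functional_on setT phi -> (forall x, u x = 0 -> phi x = 0) ->
  exists psi, functional_on setT psi /\ forall x, psi (u x) = phi x.
Proof.
move=> fdY phiL uphi.
pose W : set Y := range u.
pose phi' y := if pselect (W y) is left ex then phi (s2val (cid2 ex)) else 0.
have phiB x y : phi (x - y) = phi x - phi y.
  by have := phiL (-1) y x I I; rewrite !scaleN1r addrC mulN1r [RHS]addrC.
have phi'E x : phi' (u x) = phi x.
  rewrite /phi'; case: pselect => [ex|[]]; last by exists x.
  case: cid2 => x' _ /= E; apply/eqP; rewrite -subr_eq0 -phiB.
  by rewrite uphi // linearB /= E subrr.
have [| |psi [psiL psiE]] := @extend_functional Y W phi' fdY.
- split; first by exists 0; rewrite ?linear0.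
  move=> c _ _ [x _ <-] [y _ <-]; exists ((c%:A : A) *: x + y) => //.
  by rewrite linearP.
- by move=> c _ _ [x _ <-] [y _ <-]; rewrite -linearP !phi'E phiL.
by exists psi; split=> // x; rewrite psiE ?phi'E //; exists x.
Qed.

End LinearAlgebra.


(** * Algebras of banded triangular matrices *)

Definition band (m n : nat) (i j : 'I_n) : bool := (i <= j < i + m)%N.

(** Coordinates identifying A with the algebra of matrices supported in the
band i <= j < i + m, where bpath i j is the matrix unit at (i, j), or zero
outside the band.  The product follows the convention of composing paths like
functions: in a * b, the path of b comes first. *)
Record band_coords (K : fieldType) (A : algType K) (n m : nat) := BandCoords {
  bcoef : A -> 'I_n -> 'I_n -> K;
  bpath : 'I_n -> 'I_n -> A;
  bcoef_linear : forall (c : K) a b i j,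
    bcoef (c *: a + b) i j = c * bcoef a i j + bcoef b i j;
  bcoef_inj : forall a b, (forall i j, bcoef a i j = bcoef b i j) -> a = b;
  bcoef_out : forall a i j, ~~ band m i j -> bcoef a i j = 0;
  bcoef1 : forall i j, bcoef 1 i j = (i == j)%:R;
  bcoefM : forall a b i j, band m i j ->
    bcoef (a * b) i j = \sum_k bcoef a k j * bcoef b i k;
  bcoef_bpath : forall i j k l,
    bcoef (bpath i j) k l = [&& band m i j, k == i & l == j]%:R }.

Section SumModule.
Variables (K : fieldType) (A : algType K) (n m : nat) (C : band_coords A n m).
Implicit Types (a : A) (i j k l : 'I_n).
Local Notation bcoef := (bcoef C).
Local Notation bpath := (bpath C).
Local Notation band := (band m).

Lemma bcoefD a a' i j : bcoef (a + a') i j = bcoef a i j + bcoef a' i j.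
Proof. by rewrite -[a]scale1r bcoef_linear mul1r scale1r. Qed.

Lemma bcoef0 i j : bcoef 0 i j = 0.
Proof. by apply: (addrI (bcoef 0 i j)); rewrite -bcoefD !addr0. Qed.

Lemma bcoefZ (c : K) a i j : bcoef (c *: a) i j = c * bcoef a i j.
Proof. by rewrite -[c *: a]addr0 bcoef_linear bcoef0 addr0. Qed.

Lemma bcoef_sum (I : Type) (r : seq I) (P : pred I) (F : I -> A) i j :
  bcoef (\sum_(s <- r | P s) F s) i j = \sum_(s <- r | P s) bcoef (F s) i j.
Proof. by elim/big_rec2: _ => [|s _ z _ <-]; rewrite ?bcoef0 ?bcoefD. Qed.

Lemma bpath_out i j : ~~ band i j -> bpath i j = 0.
Proof.
move=> /negPf nb; apply: (@bcoef_inj _ _ _ _ C) => k l.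
by rewrite bcoef0 bcoef_bpath nb.
Qed.

(** The bound j <= b is essential: for j > b the left side is zero, but the
right side need not be. *)
Lemma bpathMl j (b : 'I_n) a : (j <= b)%N ->
  bpath j b * a = \sum_i bcoef a i j *: bpath i b.
Proof.
move=> jb; apply: (@bcoef_inj _ _ _ _ C) => k l.
rewrite bcoef_sum; under [RHS]eq_bigr => i _ do rewrite bcoefZ bcoef_bpath.
case: (boolP (band k l)) => [bkl|nb]; last first.
  rewrite bcoef_out // big1 // => i _.
  by case: and3P => [[bib /eqP ki /eqP lb]|]; rewrite ?mulr0 //;
     move: nb; rewrite ki lb bib.
rewrite bcoefM // (bigD1 j) //= big1 ?addr0 => [|i ij]; last first.
  by rewrite bcoef_bpath (negPf ij) andbF mul0r.
rewrite (bigD1 k) //= [X in _ + X]big1 ?addr0 => [|i ik]; last first.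
  by rewrite [k == i]eq_sym (negPf ik) andbF mulr0.
rewrite bcoef_bpath !eqxx /= mulrC.
case: eqP bkl => [-> bkb|]; last by rewrite !andbF !mulr0.
rewrite bkb !andbT; case: (boolP (band k j)) => [bkj|/(bcoef_out C) ->].
  by suff -> : band j b by []; move: bkb bkj jb; rewrite /band; lia.
by rewrite !mul0r.
Qed.

Lemma bpathMr a i (b : 'I_n) : (b <= i)%N ->
  a * bpath b i = \sum_j bcoef a i j *: bpath b j.
Proof.
move=> bi; apply: (@bcoef_inj _ _ _ _ C) => k l.
rewrite bcoef_sum; under [RHS]eq_bigr => j _ do rewrite bcoefZ bcoef_bpath.
case: (boolP (band k l)) => [bkl|nb]; last first.
  rewrite bcoef_out // big1 // => j _.
  by case: and3P => [[bib /eqP ki /eqP lb]|]; rewrite ?mulr0 //;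
     move: nb; rewrite ki lb bib.
rewrite bcoefM // (bigD1 i) //= big1 ?addr0 => [|j ij]; last first.
  by rewrite bcoef_bpath (negPf ij) !andbF mulr0.
rewrite (bigD1 l) //= [X in _ + X]big1 ?addr0 => [|j ij]; last first.
  by rewrite [l == j]eq_sym (negPf ij) !andbF mulr0.
rewrite bcoef_bpath !eqxx /= !andbT.
case: eqP bkl => [-> bkb|]; last by rewrite !andbF !mulr0.
rewrite bkb !andbT; case: (boolP (band i l)) => [bkj|/(bcoef_out C) ->].
  by suff -> : band b i by []; move: bkb bkj bi; rewrite /band; lia.
by rewrite !mul0r.
Qed.

(** * Direct sums of interval modules *)

Variable T : finType.
Implicit Types (x y : T -> nat) (t : T).

(** For x t <= n, the support of summand t is the interval with socle x t - 1
and top x t - m, cut off at 0; it is empty when x t = 0. *)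
Definition supp x t i : bool := (i < x t <= i + m)%N.

(** The sum over t of the interval modules given by x.  The coordinates of A
appear as a parameter because they determine the action. *)
Definition sumMod (_ : band_coords A n m) x : Type :=
  {ffun {p : T * 'I_n | supp x p.1 p.2} -> K}.
HB.instance Definition _ x := GRing.Zmodule.on (sumMod C x).

Section Shape.
Variable x : T -> nat.
Local Notation M := (sumMod C x).
Implicit Types f g : M.

(** Extending by zero outside the support makes all sums range over all
vertices. *)
Definition entry f t i : K :=
  if insub (t, i) is Some p then (f : {ffun _ -> K}) p else 0.

Definition of_entries (h : T -> 'I_n -> K) : M :=
  [ffun p : {p : T * 'I_n | supp x p.1 p.2} => h (val p).1 (val p).2].

Lemma entry_of h t i : entry (of_entries h) t i = if supp x t i then h t i else 0.
Proof.
rewrite /entry; case: insubP => [p /= s pE|/negPf /= -> //].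
by rewrite ffunE /= pE /= s.
Qed.

Lemma entry_out f t i : ~~ supp x t i -> entry f t i = 0.
Proof. by rewrite /entry => s; rewrite insubN. Qed.

Lemma entry_ext f g : (forall t i, supp x t i -> entry f t i = entry g t i) -> f = g.
Proof.
move=> fg; apply/ffunP => -[[t i] /= s].
have := fg t i s; rewrite /entry.
by rewrite (@insubT _ (fun p : T * 'I_n => supp x p.1 p.2) _ (t, i) s).
Qed.

Lemma entryD f g t i : entry (f + g) t i = entry f t i + entry g t i.
Proof. by rewrite /entry; case: insub => [p|]; rewrite ?ffunE ?addr0. Qed.

Lemma entry0 t i : entry 0 t i = 0.
Proof. by apply: (addrI (entry 0 t i)); rewrite -entryD !addr0. Qed.

Definition act a f : M := of_entries (fun t j => \sum_i bcoef a i j * entry f t i).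

Lemma entry_act a f t j : supp x t j ->
  entry (act a f) t j = \sum_i bcoef a i j * entry f t i.
Proof. by move=> s; rewrite entry_of s. Qed.

(** Two facts make the action associative: intervals are convex, so that every
intermediate vertex of a path between supported vertices is supported, and they
have at most m vertices, so that such a path is never a zero relation. *)
Lemma act_act a b f : act a (act b f) = act (a * b) f.
Proof.
apply: entry_ext => t j sj; rewrite !entry_act //.
transitivity (\sum_k \sum_i bcoef a k j * bcoef b i k * entry f t i).
  apply: eq_bigr => k _; rewrite entry_of; case: ifP => [_|/negP sk].
    by rewrite mulr_sumr; under eq_bigr do rewrite mulrA.
  rewrite mulr0 big1 // => i _.
  case: (boolP (supp x t i)) => [si|/entry_out ->]; last by rewrite mulr0.
  case: (boolP (band k j)) => [bkj|/(bcoef_out C) ->]; last by rewrite !mul0r.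
  case: (boolP (band i k)) => [bik|/(bcoef_out C) ->]; last by rewrite mulr0 mul0r.
  by case: sk; move: sj si bkj bik; rewrite /supp /band; lia.
rewrite exchange_big; apply: eq_bigr => i _ /=; rewrite -mulr_suml.
case: (boolP (supp x t i)) => [si|/entry_out ->]; last by rewrite !mulr0.
congr (_ * _); case: (boolP (band i j)) => [bij|nb]; first by rewrite bcoefM.
rewrite (bcoef_out C) // big1 // => k _.
case: (boolP (band k j)) => [bkj|/(bcoef_out C) ->]; last by rewrite !mul0r.
case: (boolP (band i k)) => [bik|/(bcoef_out C) ->]; last by rewrite mulr0.
by move: sj si bkj bik nb; rewrite /supp /band; lia.
Qed.

Lemma act1 : left_id 1 act.
Proof.
move=> f; apply: entry_ext => t j sj; rewrite entry_act //.
rewrite (bigD1 j) //= bcoef1 eqxx mul1r big1 ?addr0 // => i /negPf ij.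
by rewrite bcoef1 ij mul0r.
Qed.

Lemma actDr : right_distributive act +%R.
Proof.
move=> a f g; apply: entry_ext => t j sj; rewrite entryD !entry_act //.
by rewrite -big_split; apply: eq_bigr => i _; rewrite entryD mulrDr.
Qed.

Lemma actDl f : {morph act^~ f : a b / a + b}.
Proof.
move=> a b; apply: entry_ext => t j sj; rewrite entryD !entry_act //.
by rewrite -big_split; apply: eq_bigr => i _; rewrite bcoefD mulrDl.
Qed.

HB.instance Definition _ :=
  GRing.Zmodule_isLmodule.Build A M act_act act1 actDr actDl.

Lemma entryZ a f t j : supp x t j ->
  entry (a *: f) t j = \sum_i bcoef a i j * entry f t i.
Proof. exact: entry_act. Qed.

Lemma entryZK (c : K) f t j : entry ((c%:A : A) *: f) t j = c * entry f t j.
Proof.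
case: (boolP (supp x t j)) => [s|ns]; last by rewrite !entry_out ?mulr0.
rewrite entryZ // (bigD1 j) //= bcoefZ bcoef1 eqxx mulr1.
by rewrite big1 ?addr0 // => i /negPf ij; rewrite bcoefZ bcoef1 ij mulr0 mul0r.
Qed.

Lemma entry_sum (I : Type) (r : seq I) (P : pred I) (F : I -> M) t i :
  entry (\sum_(s <- r | P s) F s) t i = \sum_(s <- r | P s) entry (F s) t i.
Proof. by elim/big_rec2: _ => [|s _ z _ <-]; rewrite ?entry0 ?entryD. Qed.

Lemma entry_bpath f t i j l : supp x t l ->
  entry (bpath i j *: f) t l = if (l == j) && band i j then entry f t i else 0.
Proof.
move=> s; rewrite entryZ // (bigD1 i) //= big1 ?addr0 => [|k /negPf ki].
  by rewrite bcoef_bpath eqxx andbC; case: ifP; rewrite ?mul1r ?mul0r.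
by rewrite bcoef_bpath ki andbF mul0r.
Qed.

Definition delta t i : M := of_entries (fun t' i' => ((t' == t) && (i' == i))%:R).

Lemma fin_dim_sumMod : fin_dim (M : lmodType A).
Proof.
apply: (@fin_dim_fin _ _ _ (T * 'I_n)%type (fun p => delta p.1 p.2)
  (fun f p => entry f p.1 p.2)) => f.
apply: entry_ext => t i s; rewrite entry_sum (bigD1 (t, i)) //=.
rewrite entryZK entry_of s !eqxx mulr1 big1 ?addr0 // => -[t' i'] /= ti.
rewrite entryZK entry_of s; case: andP => [[/eqP tt /eqP ii]|]; rewrite ?mulr0 //.
by rewrite tt ii eqxx in ti.
Qed.

End Shape.

(** Push a nonzero element of a submodule along a path as far as possible: what
survives at the last vertex cannot be moved any further, so it lies in the
socle. *)
Lemma essential_of_socle y (N : set (sumMod C y)) : (forall t, (y t <= n)%N) ->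
  (forall f, (forall t i, i.+1 != y t -> entry f t i = 0) -> N f) ->
  essential N.
Proof.
move=> yn socN N' [_ _ N'Z] [f N'f f0].
pose P (p : T * 'I_n * 'I_n) :=
  [&& entry f p.1.1 p.1.2 != 0, supp y p.1.1 p.2 & (p.1.2 <= p.2)%N].
have [p0 Pp0] : exists p, P p.
  apply: contrapT => /forallNP noP; apply: f0; apply: entry_ext => t i s.
  rewrite entry0; apply/eqP; apply: contrapT => /negP fti.
  by apply: (noP (t, i, i)); rewrite /P /= fti s leqnn.
case: (@arg_maxnP _ p0 P (fun p => p.2 : nat) Pp0) => -[[t i] j] /=.
case/and3P => /= fti sj ij jmax.
have si : supp y t i by apply: contraNT fti => /entry_out ->.
have bij : band i j by move: si sj ij; rewrite /supp /band; lia.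
exists (bpath i j *: f); split; last 1 first.
- move=> /(congr1 (fun g => entry g t j)); rewrite entry_bpath // eqxx bij entry0.
  by move/eqP; rewrite (negPf fti).
- apply: socN => t' l ly.
  case: (boolP (supp y t' l)) => [sl|/entry_out -> //].
  rewrite entry_bpath // bij andbT; case: (l =P j) => // lj; apply/eqP.
  apply: contrapT => /negP ft'i.
  have ln : (l.+1 < n)%N by have := yn t'; move: sl ly; rewrite /supp; lia.
  have /jmax /= : P (t', i, Ordinal ln).
    rewrite /P /= ft'i /=; move: sl ly ij (congr1 val lj).
    by rewrite /supp /=; lia.
  by rewrite /= -lj ltnn.
- exact: N'Z.
Qed.

(** A linear map to a sum of modules I(x t) is determined by its coordinates at
the socle vertices x t - 1, and these can be arbitrary functionals.  So maps
extend because functionals do.  Allowing u to have a kernel contained in that of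
f gives the extension along the image of a differential, as needed to build
chain maps. *)
Lemma extend_to_sumMod x (X Y : lmodType A) (u : {linear X -> Y})
    (f : {linear X -> sumMod C x}) :
  (forall t, (x t <= n)%N) -> fin_dim Y -> (forall z, u z = 0 -> f z = 0) ->
  exists g : {linear Y -> sumMod C x}, forall z, g (u z) = f z.
Proof.
move=> xn fdY uf.
(* Functionals are extended for all vertices b; only the one with
   b + 1 = x t, if any, enters the sum that defines g0. *)
have psiP t b : exists psi : Y -> K, functional_on setT psi /\
    forall z, psi (u z) = entry (f z) t b.
  apply: factor_functional => // [c z z' _ _|z /uf ->]; last by rewrite entry0.
  by rewrite linearP entryD entryZK.
have [psi psiL] := choice (fun p : T * 'I_n => psiP p.1 p.2).
pose g0 (w : Y) : sumMod C x :=
  of_entries x (fun t j => \sum_(b : 'I_n | b.+1 == x t) psi (t, b) (bpath j b *: w)).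
have g0E w t j (b : 'I_n) : supp x t j -> b.+1 = x t ->
    entry (g0 w) t j = psi (t, b) (bpath j b *: w).
  move=> s bE; rewrite entry_of s (big_pred1 b) // => b' /=.
  by rewrite -bE eqSS.
have socle t j : supp x t j ->
    exists b : 'I_n, [/\ b.+1 = x t, (j <= b)%N & band j b].
  move=> s; have bn : ((x t).-1 < n)%N by have := xn t; move: s; rewrite /supp; lia.
  exists (Ordinal bn); move: s; rewrite /supp /band /=; split; lia.
have g0L : linear g0.
  move=> a y z; apply: entry_ext => t j s.
  have [b [bE jb bjb]] := socle t j s.
  rewrite entryD entryZ // !(g0E _ _ _ _ s bE).
  have psiD v w : psi (t, b) (v + w) = psi (t, b) v + psi (t, b) w.
    by have := (psiL (t, b)).1 1 v w I I; rewrite scale1r scale1r mul1r.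
  have psi0 : psi (t, b) 0 = 0.
    by apply: (addrI (psi (t, b) 0)); rewrite -psiD !addr0.
  have psiZ c v : psi (t, b) ((c%:A : A) *: v) = c * psi (t, b) v.
    by have := (psiL (t, b)).1 c v 0 I I; rewrite !addr0 psi0 addr0.
  rewrite scalerDr psiD; congr (_ + _).
  rewrite scalerA bpathMl // scaler_suml.
  have -> (r : seq 'I_n) F :
      psi (t, b) (\sum_(i <- r) F i) = \sum_(i <- r) psi (t, b) (F i).
    by elim/big_rec2: _ => // i v w _ <-.
  apply: eq_bigr => i _.
  rewrite -[bcoef a i j *: _]mul1r -scalerAr scalerAl -scalerA psiZ.
  case: (boolP (supp x t i)) => si; first by rewrite (g0E _ _ _ _ si bE).
  rewrite entry_out //.
  case: (boolP (band i b)) => [bib|/bpath_out ->]; last by rewrite scale0r psi0.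
  case: (boolP (band i j)) => [bij|/(bcoef_out C) ->]; last by rewrite !mul0r.
  by move: si bib bij; rewrite /supp -bE /band; lia.
exists (mk_linear g0L) => z; apply: entry_ext => t j s.
have [b [bE jb bjb]] := socle t j s.
change (entry (g0 (u z)) t j = entry (f z) t j).
rewrite (g0E _ _ _ _ s bE) -linearZ (psiL (t, b)).2 /= linearZ.
rewrite entry_bpath ?eqxx ?bjb //.
by move: bjb s; rewrite /supp -bE /band; lia.
Qed.

End SumModule.

Section SumModuleMaps.
Variables (K : fieldType) (A : algType K) (n m : nat) (C : band_coords A n m).
Variable T : finType.
Implicit Types (a : A) (i j k l : 'I_n) (x y : T -> nat) (t : T).
Local Notation bcoef := (bcoef C).
Local Notation bpath := (bpath C).
Local Notation band := (band m).
Local Notation supp := (supp m).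

Lemma injective_sumMod x : (forall t, (x t <= n)%N) ->
  injective_module (sumMod C x : lmodType A).
Proof.
move=> xn; split=> [|X Y _ fdY u f u_inj]; first exact: fin_dim_sumMod.
apply: extend_to_sumMod => // z uz; suff -> : z = 0 by rewrite linear0.
by apply: u_inj; rewrite uz linear0.
Qed.

(** If x t >= m, then summand t is the whole projective module generated at
its top x t - m: a map out of it is given by choosing the image of the
generator. *)
Lemma projective_sumMod x : (forall t, x t = 0%N \/ (m <= x t <= n)%N) ->
  projective_module (sumMod C x : lmodType A).
Proof.
move=> xP; split=> [|X Y _ _ u f u_surj]; first exact: fin_dim_sumMod.
have [v vE] := choice (fun p : T * 'I_n => u_surj (f (delta C x p.1 p.2))).
pose c (h : sumMod C x) t (b : 'I_n) : A := \sum_j entry h t j *: bpath b j.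
pose g0 h : X := \sum_t \sum_(b : 'I_n | (b + m)%N == x t) c h t b *: v (t, b).
have cZ a h t (b : 'I_n) : (b + m)%N = x t -> a * c h t b = c (a *: h) t b.
  move=> bx; rewrite mulr_sumr.
  transitivity (\sum_j \sum_l (bcoef a j l * entry h t j) *: bpath b l).
    apply: eq_bigr => j _; rewrite -scalerAr.
    case: (boolP (supp x t j)) => [s|/entry_out ->]; last first.
      by rewrite scale0r big1 // => l _; rewrite mulr0 scale0r.
    rewrite bpathMr ?scaler_sumr; last by move: s; rewrite /supp -bx; lia.
    by apply: eq_bigr => l _; rewrite scalerA mulrC.
  rewrite exchange_big; apply: eq_bigr => l _ /=; rewrite -scaler_suml.
  case: (boolP (supp x t l)) => [s|ns]; first by rewrite entryZ.
  rewrite bpath_out ?scaler0 //.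
  by move: ns; rewrite /supp /band -bx; lia.
have g0L : linear g0.
  move=> a h h'; rewrite scaler_sumr -big_split; apply: eq_bigr => t _ /=.
  rewrite scaler_sumr -big_split; apply: eq_bigr => b /eqP bx /=.
  rewrite scalerA cZ // -scalerDl; congr (_ *: _).
  by rewrite -big_split; apply: eq_bigr => j _; rewrite entryD scalerDl.
exists (mk_linear g0L) => h; change (u (g0 h) = f h).
transitivity (f (\sum_t \sum_(b : 'I_n | (b + m)%N == x t) c h t b *: delta C x t b)).
  rewrite !linear_sum; apply: eq_bigr => t _; rewrite !linear_sum.
  by apply: eq_bigr => b _; rewrite !linearZ vE.
congr (f _); apply: entry_ext => t i s; rewrite entry_sum.
have [b bx] : exists b : 'I_n, (b + m)%N = x t.
  have xm : (x t - m < n)%N by have := xP t; move: s; rewrite /supp; lia.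
  by exists (Ordinal xm) => /=; have := xP t; move: s; rewrite /supp; lia.
have sb : supp x t b by have := xP t; move: s; rewrite /supp -bx; lia.
have bi : band b i by move: s; rewrite /supp /band -bx; lia.
rewrite (bigD1 t) //= [X in _ + X]big1 ?addr0 => [|t' tt']; last first.
  rewrite entry_sum big1 // => b' _; rewrite entryZ // big1 // => k _.
  by rewrite entry_of [t == t']eq_sym (negPf tt') if_same mulr0.
rewrite (big_pred1 b) => [|b']; last by rewrite -bx eqn_add2r.
rewrite entryZ // (bigD1 b) //= big1 ?addr0 => [|k kb]; last first.
  by rewrite entry_of (negPf kb) andbF if_same mulr0.
rewrite entry_of sb !eqxx mulr1 bcoef_sum (bigD1 i) //= big1 ?addr0 => [|k ki].
  by rewrite bcoefZ bcoef_bpath bi !eqxx mulr1.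
by rewrite bcoefZ bcoef_bpath [i == k]eq_sym (negPf ki) !andbF mulr0.
Qed.

(** For y <= x, the interval of y t meets that of x t in a quotient of the latter
that is also a submodule of the former; restricting to the common support is
the composite of these two maps. *)
Section Truncation.
Variables x y : T -> nat.
Hypothesis yx : forall t, (y t <= x t)%N.

Definition trunc_fun (f : sumMod C x) : sumMod C y := of_entries C y (entry f).

Lemma trunc_linear : linear trunc_fun.
Proof.
move=> a f g; apply: entry_ext => t j sy.
rewrite entryD entryZ // !entry_of sy entryD; congr (_ + _).
case: (boolP (supp x t j)) => [sx|nsx]; last first.
  rewrite entry_out // big1 // => i _; rewrite entry_of.
  case: ifP => [si|_]; last by rewrite mulr0.
  case: (boolP (band i j)) => [bij|/(bcoef_out C) ->]; last by rewrite mul0r.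
  rewrite entry_out ?mulr0 //; apply: contra nsx.
  by move: sy si bij (yx t); rewrite /supp /band; lia.
rewrite entryZ //; apply: eq_bigr => i _; rewrite entry_of.
case: ifP => // /negP nsy.
case: (boolP (supp x t i)) => [si|/entry_out -> //].
case: (boolP (band i j)) => [bij|/(bcoef_out C) ->]; last by rewrite !mul0r.
by case: nsy; move: sy si bij (yx t); rewrite /supp /band; lia.
Qed.

Definition trunc : {linear sumMod C x -> sumMod C y} := mk_linear trunc_linear.

Lemma entry_trunc f t i :
  entry (trunc f) t i = if supp y t i then entry f t i else 0.
Proof. exact: entry_of. Qed.

Lemma trunc_eq0 f : trunc f = 0 <-> forall t i, supp y t i -> entry f t i = 0.
Proof.
split=> [f0 t i s|f0].
  by move/(congr1 (fun g => entry g t i)): f0; rewrite entry_trunc s entry0.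
by apply: entry_ext => t i s; rewrite entry_trunc s f0 // entry0.
Qed.

Lemma range_trunc g :
  range trunc g <-> forall t i, ~~ supp x t i -> entry g t i = 0.
Proof.
split=> [[f _ <-] t i ns|g0]; first by rewrite entry_trunc entry_out ?if_same.
exists (of_entries C x (entry g)) => //; apply: entry_ext => t i s.
by rewrite entry_trunc s entry_of; case: ifPn => // /g0 ->.
Qed.

End Truncation.

(** For 0 < x t < m, lengthen interval t to m vertices, keeping its top 0.  A
splitting of the projection onto the short interval would send its generator,
which is killed by the path 0 -> x t, to an element that is not. *)
Lemma not_projective_short x t (P : lmodType A) (phi : {linear P -> sumMod C x}) :
  injective phi -> (forall h, exists z, phi z = h) ->
  (m <= n)%N -> (0 < x t < m)%N -> ~ projective_module P.
Proof.
move=> phi_inj phi_surj mn xt [_ Pproj].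
pose y t' := if t' == t then m else x t'.
have xy t' : (x t' <= y t')%N by rewrite /y; case: eqP => // ->; lia.
have [h|g gE] := Pproj _ _ (fin_dim_sumMod C y) (fin_dim_sumMod C x) (trunc xy) phi.
  suff [f _ <-] : range (trunc xy) h by exists f.
  apply/range_trunc => t' i ns; apply: entry_out; apply: contra ns.
  by rewrite /supp /y; case: eqP => // ->; lia.
have n0 : (0 < n)%N by lia.
have xn : (x t < n)%N by lia.
pose o := Ordinal n0; pose b := Ordinal xn.
have so : supp x t o by rewrite /supp /=; lia.
have ob : band o b by rewrite /band /=; lia.
have [z zE] := phi_surj (delta C x t o).
have bz : bpath o b *: z = 0.
  apply: phi_inj; rewrite linearZ linear0 /= zE; apply: entry_ext => t' i s.
  rewrite entry0 entry_bpath //; case: andP => // -[/eqP ib _].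
  rewrite entry_of; case: (t' =P t) => [tt|_]; rewrite ?if_same //.
  by move: s; rewrite tt ib /supp /= ltnn.
have := congr1 (fun z => entry (g z) t b) bz.
rewrite /= linearZ linear0 entry0 /= entry_bpath; last first.
  by rewrite /supp /y eqxx /=; lia.
rewrite eqxx ob /=.
have : entry (trunc xy (g z)) t o = entry (phi z) t o by rewrite gE.
rewrite (entry_trunc xy) so zE entry_of so !eqxx => -> /eqP.
by rewrite oner_eq0.
Qed.

End SumModuleMaps.

(** * Uniqueness of minimal injective resolutions *)

Section Uniqueness.
Variables (K : fieldType) (A : algType K).
Implicit Types M X Y I J : lmodType A.

(** Injectivity of I in a form that also covers maps u with a kernel;
[extend_to_sumMod] gives it for the explicit modules. *)
Definition extends_into I : Prop :=
  forall X Y (u : {linear X -> Y}) (f : {linear X -> I}), fin_dim Y ->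
  (forall z, u z = 0 -> f z = 0) -> exists g : {linear Y -> I}, forall z, g (u z) = f z.

Definition bij_linear X Y (f : X -> Y) : Prop :=
  injective f /\ forall y, exists x, f x = y.

Lemma linear_inj X Y (f : {linear X -> Y}) :
  (forall x, f x = 0 -> x = 0) -> injective f.
Proof.
move=> f0 x y fxy; apply/eqP; rewrite -subr_eq0; apply/eqP; apply: f0.
by rewrite linearB /= fxy subrr.
Qed.

(** The kernel of f is a submodule meeting an essential one trivially. *)
Lemma essential_inj X Y (N : set X) (f : {linear X -> Y}) : essential N ->
  (forall x, N x -> f x = 0 -> x = 0) -> injective f.
Proof.
move=> Ness Nf; apply: linear_inj => x fx; apply: contrapT => x0.
have [||y [Ny /= fy]] := Ness (fun z => f z = 0); last by case; exact: Nf.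
  split=> [|z z' /= fz fz'|a z /= fz]; first exact: linear0.
    by rewrite linearD /= fz fz' addr0.
  by rewrite linearZ /= fz scaler0.
by exists x.
Qed.

(** Uniqueness of the injective envelope, for the images of u and u': the
extension psi is injective because the image of u is essential.  It has a
retraction r because J is injective, and r is injective because the image of u'
is essential; so psi is bijective. *)
Lemma essential_extension_iso X X' J J' (phi : {linear X -> X'})
    (u : {linear X -> J}) (u' : {linear X' -> J'}) :
  bij_linear phi -> (forall z, u' (phi z) = 0 <-> u z = 0) ->
  injective_module J -> fin_dim J' -> extends_into J' ->
  essential (range u) -> essential (range u') ->
  exists psi : {linear J -> J'}, bij_linear psi /\ forall z, psi (u z) = u' (phi z).
Proof.
move=> [phi_inj phi_surj] uu' [fdJ Jinj] fdJ' J'ext uess u'ess.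
have fL : linear (u' \o phi) by move=> a z z'; rewrite /= !linearP.
have [z /uu' //|psi psiE] := J'ext _ _ u (mk_linear fL) fdJ.
have {}psiE z : psi (u z) = u' (phi z) by exact: psiE.
have psi_inj : injective psi.
  by apply: essential_inj uess _ => _ [z _ <-]; rewrite psiE => /uu'.
have idL : linear (@idfun J) by [].
have [r rE] := Jinj _ _ fdJ fdJ' psi (mk_linear idL) psi_inj.
have {}rE z : r (psi z) = z by exact: rE.
have r_inj : injective r.
  apply: essential_inj u'ess _ => _ [z' _ <-].
  by have [z <-] := phi_surj z'; rewrite -psiE rE => ->; rewrite linear0.
exists psi; split=> //; split=> // y; exists (r y).
by apply: r_inj; rewrite rE.
Qed.

(** The isomorphisms form a chain map; commutation with the differentials is
kept in the weak form that phi matches the kernels of d k and d' k, which is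
all that the next step uses. *)
Lemma min_injective_resolution_iso M (I I' : nat -> lmodType A)
    (e : {linear M -> I 0%N}) (d : forall k, {linear I k -> I k.+1})
    (e' : {linear M -> I' 0%N}) (d' : forall k, {linear I' k -> I' k.+1}) :
  min_injective_resolution e d -> min_injective_resolution e' d' ->
  (forall k, extends_into (I' k)) ->
  forall k, exists phi : {linear I k -> I' k}, bij_linear phi.
Proof.
move=> [Iinj e_inj exe exd [eess dess]] [I'inj e'_inj exe' exd' [e'ess d'ess]] ext k.
suff [phi [phiB _]] : exists phi : {linear I k -> I' k},
    bij_linear phi /\ forall z, d' k (phi z) = 0 <-> d k z = 0 by exists phi.
elim: k => [|k [phi [phiB phid]]].
- have idL : linear (@idfun M) by [].
  have [| |phi [phiB phiE]] := essential_extension_iso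
    (phi := mk_linear idL) (u := e) (u' := e') _ _ (Iinj 0%N) (I'inj 0%N).1 (ext 0%N) eess e'ess.
  + by split=> [x y //|y]; exists y.
  + move=> z; change (e' z = 0 <-> e z = 0).
    split=> [E|E].
      by rewrite (_ : z = 0) ?linear0 //; apply: e'_inj; rewrite linear0.
    by rewrite (_ : z = 0) ?linear0 //; apply: e_inj; rewrite linear0.
  exists phi; split=> // z; rewrite exe exe'; split=> [[w _ E]|[w _ <-]].
    by exists w => //; apply: phiB.1; rewrite phiE.
  by rewrite phiE; exists w.
- have [psi [psiB psiE]] := essential_extension_iso phiB phid (Iinj k.+1)
    (I'inj k.+1).1 (ext k.+1) (dess k) (d'ess k).
  exists psi; split=> // z; rewrite exd exd'; split=> [[w' _ E]|[w _ <-]].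
    by have [w wE] := phiB.2 w'; exists w => //; apply: psiB.1; rewrite psiE wE.
  by rewrite psiE; exists (phi w).
Qed.

End Uniqueness.

(** * The resolution of the regular module *)

Section Shape.
Variables n m : nat.
Implicit Types (t i : 'I_n) (k l : nat).

(** The parameter x of the summand I(x) that P_t contributes to term k of the
resolution: t + m, 0, 0, ... if P_t is injective, and otherwise
n, t, n - m, t - m, ...  Truncated subtraction makes the resolution end in
zero modules. *)
Definition shape k t : nat :=
  if (t + m <= n)%N then (if k == 0%N then t + m else 0)%N
  else ((if odd k then t : nat else n) - k./2 * m)%N.

Lemma shapeSS k t : (n < t + m)%N -> shape k.+2 t = (shape k t - m)%N.
Proof.
rewrite /shape ltnNge => /negPf -> /=; rewrite negbK mulSn; lia.
Qed.

(** The successive gaps n - t and t - (n - m) repeat and lie strictly between 0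
and m; the weak inequalities remain valid once the parameters reach 0. *)
Lemma shape_step k t : (n < t + m)%N ->
  [/\ (shape k.+1 t <= shape k t <= shape k.+1 t + m)%N,
      (0 < shape k t -> shape k.+1 t < shape k t)%N
    & (0 < shape k.+1 t -> shape k t < shape k.+1 t + m)%N].
Proof.
move=> tm; elim: k => [|k [H1 H2 H3]].
  have := ltn_ord t; rewrite /shape [(t + m <= n)%N]leqNgt tm /=; split; lia.
by rewrite shapeSS //; split; lia.
Qed.

Lemma shape_proj_inj t : (t + m <= n)%N -> forall k, shape k.+1 t = 0%N.
Proof. by move=> tm k; rewrite /shape tm. Qed.

Lemma shape_anti k t : (shape k.+1 t <= shape k t)%N.
Proof.
have [tm|tm] := leqP (t + m) n; last by have [/andP []] := shape_step k tm.
by rewrite shape_proj_inj.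
Qed.

Lemma shape0 t : shape 0 t = minn (t + m) n.
Proof. by rewrite /shape /=; case: leqP; lia. Qed.

Lemma shape1 t : shape 1 t = if (t + m <= n)%N then 0%N else t.
Proof. by rewrite /shape /= subn0. Qed.

Lemma shape_le k t : (shape k t <= n)%N.
Proof.
elim: k => [|k]; first by rewrite shape0; lia.
exact: leq_trans (shape_anti k t).
Qed.

(** The pointwise form of exactness: kernel and image of consecutive
differentials are the elements supported off the next and on the previous
interval.  For non-injective P_t it holds since x_(k+2) = x_k - m: the next
interval ends just before the previous one starts. *)
Lemma shape_exact k t i : supp m (shape k.+1) t i ->
  supp m (shape k.+2) t i = ~~ supp m (shape k) t i.
Proof.
have [tm|tm] := leqP (t + m) n; first by rewrite /supp shape_proj_inj.
have [] := shape_step k tm; have [] := shape_step k.+1 tm.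
rewrite /supp shapeSS //; lia.
Qed.

Lemma shape_socle k t i : i.+1 = shape k.+1 t -> supp m (shape k) t i.
Proof.
have [tm|tm] := leqP (t + m) n; first by rewrite /supp shape_proj_inj.
by have [] := shape_step k tm; rewrite /supp; lia.
Qed.

Hypotheses (m_ge2 : (2 <= m)%N) (mn : (m < n)%N).
Let D := (n %/ m + (n - m).+1 %/ m)%N.

(** For t = n - m + 1, the first quotient counts the projective terms at even
positions of the resolution, and the second those at odd positions. *)
Let divs : [/\ n = (n %/ m * m + n %% m)%N, (n %% m < m)%N,
  (n - m).+1 = ((n - m).+1 %/ m * m + (n - m).+1 %% m)%N, ((n - m).+1 %% m < m)%N
  & (n %/ m = (n - m).+1 %/ m)%N \/ (n %/ m = ((n - m).+1 %/ m).+1)%N].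
Proof.
have m0 : (0 < m)%N by lia.
have En := divn_eq n m; have Em := divn_eq (n - m).+1 m.
have Rn := ltn_pmod n m0; have Rm := ltn_pmod (n - m).+1 m0.
by split=> //; move: En Em Rn Rm; set a := (n %/ m)%N; set b := (_ %/ m)%N;
   set r := (_ %% m)%N; set s := (_ %% m)%N; nia.
Qed.

Lemma shape_projective k t : (k < D)%N -> shape k t = 0%N \/ (m <= shape k t <= n)%N.
Proof.
move=> kD; rewrite shape_le andbT /shape.
case: leqP => [tm|tm]; first by case: ifP => _; [right; lia | left].
right; have [En Rn Em Rm ab] := divs; have Ek := odd_double_half k.
move: kD En Em Rn Rm ab; rewrite /D; set a := (n %/ m)%N; set b := (_ %/ m)%N.
move=> kD En Em Rn Rm ab.
case: odd Ek => /= Ek.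
  have : (k./2.+1 * m <= b * m)%N by rewrite leq_pmul2r; lia.
  by rewrite mulSn; lia.
have : (k./2.+1 * m <= a * m)%N by rewrite leq_pmul2r; lia.
by rewrite mulSn; lia.
Qed.

(** The witness t = n - m + 1 is the first non-injective P_t.  If the quotients
agree, the failing term is I(n mod m); otherwise it is
I((n - m + 1) mod m).  Neither remainder is zero in its case. *)
Lemma shape_not_projective : exists t, (0 < shape D t < m)%N.
Proof.
have tn : ((n - m).+1 < n)%N by lia.
exists (Ordinal tn); rewrite /shape /=.
have -> : ((n - m).+1 + m <= n)%N = false by lia.
have [En Rn Em Rm ab] := divs; have ED := odd_double_half D.
move: En Em Rn Rm ab ED; rewrite /D; set a := (n %/ m)%N; set b := (_ %/ m)%N.
move=> En Em Rn Rm ab ED.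
case: odd ED => /= ED.
  have -> : ((a + b)./2 = b)%N by lia.
  have ab1 : a = b.+1 by lia.
  by move: En; rewrite ab1 mulSn; lia.
have -> : ((a + b)./2 = a)%N by lia.
have ab1 : a = b by lia.
by move: En; rewrite ab1; lia.
Qed.

End Shape.

Section Resolution.
Variables (K : fieldType) (A : algType K) (n m : nat) (C : band_coords A n m).
Hypotheses (m_ge2 : (2 <= m)%N) (mn : (m < n)%N).
Implicit Types (t i j : 'I_n) (k : nat).

Let I k : lmodType A := sumMod C (@shape n m k).

(** The family of coefficients of a at the paths from t is the component of a
in P_t, which sits inside I(min(t + m, n)). *)
Definition reg_emb_fun (a : A^o) : I 0%N := of_entries C (@shape n m 0) (bcoef C a).

Lemma supp_shape0 t j : supp m (@shape n m 0) t j -> (t <= j)%N = band m t j.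
Proof. by rewrite /supp /band shape0; have := ltn_ord j; lia. Qed.

Lemma band_supp_shape0 t j : band m t j -> supp m (@shape n m 0) t j.
Proof. by rewrite /supp /band shape0; have := ltn_ord j; lia. Qed.

Lemma reg_emb_linear : linear reg_emb_fun.
Proof.
move=> a b b'; apply: entry_ext => t j s.
rewrite entryD entryZ // !entry_of s bcoefD; congr (_ + _).
change (bcoef C (a * b) t j = \sum_i bcoef C a i j * entry (reg_emb_fun b) t i).
transitivity (\sum_k bcoef C a k j * bcoef C b t k).
  case: (boolP (band m t j)) => [tj|ntj]; first by rewrite bcoefM.
  rewrite bcoef_out // big1 // => k _.
  case: (boolP (band m k j)) => [kj|/(bcoef_out C) ->]; last by rewrite mul0r.
  case: (boolP (band m t k)) => [tk|/(bcoef_out C) ->]; last by rewrite mulr0.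
  by move: ntj; rewrite -supp_shape0 //; move: tk kj; rewrite /band; lia.
apply: eq_bigr => k _; rewrite entry_of; case: ifP => // /negP ns.
by rewrite [bcoef C b t k]bcoef_out //; apply/negP => /band_supp_shape0.
Qed.

Definition reg_emb : {linear A^o -> I 0%N} := mk_linear reg_emb_linear.

Lemma entry_reg_emb a t j : entry (reg_emb a) t j = bcoef C a t j.
Proof.
rewrite [LHS]entry_of; case: ifP => // /negP ns.
by rewrite bcoef_out //; apply/negP => /band_supp_shape0.
Qed.

Lemma reg_emb_inj : injective reg_emb.
Proof.
move=> a b E; apply: (@bcoef_inj _ _ _ _ C) => t j.
by rewrite -!entry_reg_emb E.
Qed.

Lemma range_reg_emb f : range reg_emb f <-> forall t j, (j < t)%N -> entry f t j = 0.
Proof.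
split=> [[a _ <-] t j tj|f0].
  by rewrite entry_reg_emb bcoef_out // /band; lia.
exists (\sum_t \sum_j entry f t j *: bpath C t j) => //.
apply: entry_ext => t j s; rewrite entry_reg_emb.
rewrite bcoef_sum (bigD1 t) //= bcoef_sum (bigD1 j) //= bcoefZ bcoef_bpath.
rewrite !eqxx !big1 ?addr0 => [|t' tt'|j' jj']; first last.
- by rewrite bcoefZ bcoef_bpath [j == j']eq_sym (negPf jj') !andbF mulr0.
- rewrite bcoef_sum big1 // => j' _.
  by rewrite bcoefZ bcoef_bpath [t == t']eq_sym (negPf tt') andbF mulr0.
rewrite -(supp_shape0 s) !andbT; case: leqP => [_|/f0 ->]; first exact: mulr1.
exact: mul0r.
Qed.

Let d k : {linear I k -> I k.+1} := trunc C (@shape_anti n m k).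

Lemma regular_resolution : min_injective_resolution reg_emb d.
Proof.
split.
- by move=> k; apply: injective_sumMod => t; exact: shape_le.
- exact: reg_emb_inj.
- move=> f; rewrite trunc_eq0 range_reg_emb; split=> f0 t i.
    move=> ti; case: (boolP (supp m (@shape n m 0) t i)) => [s|/entry_out -> //].
    apply: f0; move: s ti; rewrite /supp shape0 shape1.
    by have := ltn_ord t; case: (leqP (t + m) n); lia.
  move=> s; have [ti|/f0 //] := leqP t i.
  by move: s; rewrite /supp shape1; case: (leqP (t + m) n); lia.
- move=> k f; rewrite trunc_eq0 range_trunc; split=> f0 t i s.
    case: (boolP (supp m (@shape n m k.+1) t i)) => [s'|/entry_out -> //].
    by apply: f0; rewrite shape_exact.
  case: (boolP (supp m (@shape n m k.+1) t i)) => [s'|/entry_out -> //].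
  by apply: f0; rewrite -shape_exact.
- split=> [|k]; apply: essential_of_socle => [t|f f0]; try exact: shape_le.
    apply/range_reg_emb => t j jt; apply: f0.
    by rewrite shape0; have := ltn_ord t; lia.
  apply/range_trunc => t i ns; apply: f0; apply: contra ns => /eqP.
  exact: shape_socle.
Qed.

Theorem dom_dim_band :
  dom_dim_eq (A^o : lmodType A) (n %/ m + (n - m).+1 %/ m).
Proof.
split.
  exists I, reg_emb, d; split; first exact: regular_resolution.
  by move=> k kD; apply: projective_sumMod => t; exact: shape_projective.
move=> [J [e [f [res Jproj]]]].
have [k|phi [phi_inj phi_surj]] := min_injective_resolution_iso res regular_resolution _
  (n %/ m + (n - m).+1 %/ m)%N.
  by move=> X Y u g; apply: extend_to_sumMod => t; exact: shape_le.
have [t tP] := shape_not_projective m_ge2 mn.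
exact: not_projective_short phi_inj phi_surj (ltnW mn) tP (Jproj _ (ltnSn _)).
Qed.

End Resolution.

(** The bounds are monotone in k, so at most one k is the exact value. *)
Lemma alg_dom_dimE (K : fieldType) (A : algType K) d :
  dom_dim_eq (A^o : lmodType A) d -> alg_dom_dim A = Some d.
Proof.
move=> [dge dlt]; rewrite /alg_dom_dim /dom_dim.
case: pselect => [ex|[]]; last by exists d.
case: cid => d' [d'ge d'lt] /=; congr Some.
have mono k k' : (k <= k')%N -> dom_dim_ge (A^o : lmodType A) k' ->
    dom_dim_ge (A^o : lmodType A) k.
  move=> kk' [I [e [f [res Iproj]]]]; exists I, e, f; split=> // i ik.
  by apply: Iproj; exact: leq_trans kk'.
case: (ltngtP d d') => // dd'.
  by case: dlt; exact: mono d'ge.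
by case: d'lt; exact: mono dge.
Qed.

(** * The truncated path algebra *)

Section TruncatedPathAlgebra.
Variables (K : fieldType) (n m : nat) (m_ge2 : (2 <= m)%N).
Local Notation path := (lpath n.-1.+1).
Local Notation vertex := 'I_n.-1.+1.
Local Notation B := (pathAlg K n).
Local Notation J := (gen_ideal (zero_relations (K := K) (n := n) m)).
Implicit Types (p q r : path) (f g : B) (i j k : vertex).

(** The sum has exactly one term if i <= j and none otherwise; this gives a
coefficient for every pair of vertices without proofs of i <= j. *)
Definition pcoef f i j : K := \sum_(p : path | (psrc p == i) && (ptgt p == j)) f p.

Lemma pcoef_path f p : pcoef f (psrc p) (ptgt p) = f p.
Proof.
by rewrite /pcoef (big_pred1 p).
Qed.

Lemma pcoefM f g i j : (i <= j)%N ->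
  pcoef (f * g) i j = \sum_k pcoef f k j * pcoef g i k.
Proof.
move=> ij; have [p <- <-] := lpath_ex ij; rewrite pcoef_path.
transitivity (\sum_q \sum_(r | is_comp q r p) f q * g r); first by rewrite [LHS]ffunE.
transitivity (\sum_k \sum_(q : path | (psrc q == k) && (ptgt q == ptgt p))
    f q * pcoef g (psrc p) (psrc q)).
  transitivity (\sum_(q : path | ptgt q == ptgt p) f q * pcoef g (psrc p) (psrc q)).
    rewrite [RHS]big_mkcond; apply: eq_bigr => q _ /=; case: eqP => [qp|/eqP/negPf qp].
      rewrite mulr_sumr; apply: eq_bigl => r.
      by rewrite /is_comp qp eqxx andbT andbC eq_sym.
    by rewrite big1 // => r; rewrite /is_comp [ptgt p == _]eq_sym qp !andbF.
  rewrite (partition_big (@psrc _) xpredT) //; apply: eq_bigr => k _ /=.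
  by apply: eq_bigl => q; rewrite andbC.
apply: eq_bigr => k _; rewrite mulr_suml; apply: eq_bigr => q /andP [/eqP -> _] //.
Qed.

(** Multiplying paths never shortens them, so vanishing on all paths shorter
than m defines an ideal. *)
Lemma ideal_short f p : f \in J -> (plen p < m)%N -> f p = 0.
Proof.
move=> /gen_idealP fJ; pose N : set B := fun f => forall p, (plen p < m)%N -> f p = 0.
move: p; apply: (fJ N); last first.
  by move=> _ [q qm ->] p pm; rewrite ffunE; case: eqP pm => // ->; rewrite qm ltnn.
split=> [p _|h h' Nh Nh' p pm|a h Nh p pm|a h Nh p pm].
- by rewrite ffunE.
- by rewrite !ffunE Nh ?Nh' ?subr0.
- rewrite [LHS]ffunE big1 // => q _; rewrite big1 // => r.
  move=> /and3P [/eqP H1 /eqP H2 /eqP H3]; rewrite (Nh r) ?mulr0 //.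
  by move: pm (psrc_le q); rewrite /plen H2 H3 -H1; lia.
- rewrite [LHS]ffunE big1 // => q _; rewrite big1 // => r.
  move=> /and3P [/eqP H1 /eqP H2 /eqP H3]; rewrite (Nh q) ?mul0r //.
  by move: pm (psrc_le r); rewrite /plen H2 H3 -H1; lia.
Qed.

Lemma path_eltM q r p : is_comp q r p ->
  path_elt K q * path_elt K r = path_elt K p.
Proof.
move=> qrp; apply/ffunP => p'; rewrite [LHS]ffunE (bigD1 q) //=.
rewrite [X in _ + X]big1 ?addr0 => [|q' /negPf qq']; last first.
  by rewrite big1 // => r' _; rewrite !ffunE qq' mul0r.
rewrite big_mkcond (bigD1 r) //= big1 ?addr0 => [|r' /negPf rr']; last first.
  by rewrite !ffunE rr' mulr0 if_same.
rewrite !ffunE !eqxx mulr1; case: (p' =P p) => [->|pp']; first by rewrite qrp.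
case: ifP => // qrp'; case: pp'.
move: qrp qrp' => /and3P [/eqP H1 /eqP H2 /eqP H3] /and3P [_ /eqP H2' /eqP H3'].
by apply: lpathP; rewrite ?H2 ?H3.
Qed.

(** A path of length at least m is a relation of length m followed by another
path. *)
Lemma ideal_of_short f : (forall p, (plen p < m)%N -> f p = 0) -> f \in J.
Proof.
move=> f0; have -> : f = \sum_p f p *: path_elt K p.
  apply/ffunP => p; rewrite sum_ffunE (bigD1 p) //= !ffunE eqxx.
  rewrite big1 ?addr0 => [|q /negPf qp]; first by rewrite [RHS]mulr1.
  by rewrite !ffunE eq_sym qp [LHS]mulr0.
apply: rpred_sum => p _; have [/f0 ->|pm] := ltnP (plen p) m.
  by rewrite scale0r rpred0.
apply: gen_idealZ.
have kn : (psrc p + m < n.-1.+1)%N.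
  by apply: leq_ltn_trans (ltn_ord (ptgt p)); move: pm; rewrite /plen; lia.
pose k : vertex := Ordinal kn.
have [|r rs rt] := @lpath_ex _ (psrc p) k; first by rewrite /= leq_addr.
have [|q qs qt] := @lpath_ex _ k (ptgt p).
  by move: pm m_ge2; rewrite /plen /=; lia.
rewrite -(@path_eltM q r p) /is_comp ?rs ?rt ?qs ?qt ?eqxx //.
apply: gen_idealMl; apply/gen_idealP => N _ RN; apply: RN.
by exists r => //; rewrite /plen rs rt /= addKn.
Qed.

Local Notation Q := (truncPathAlg K n m_ge2).
Local Notation proj :=
  (@quot_proj K B (zero_relations m) (zero_relations_proper K n m_ge2)).

Definition tcoef (a : Q) i j : K := if band m i j then pcoef (quot_repr a) i j else 0.

Definition tpath i j : Q :=
  if band m i j then proj [ffun p => ((psrc p == i) && (ptgt p == j))%:R] else 0.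

(** Coefficients at paths shorter than m do not depend on the representative. *)
Lemma tcoef_proj f i j : tcoef (proj f) i j = if band m i j then pcoef f i j else 0.
Proof.
rewrite /tcoef; case: ifP => // bij; apply/eqP.
rewrite -subr_eq0; apply/eqP; rewrite -sumrB big1 // => p /andP [/eqP pi /eqP pj].
have pm : (plen p < m)%N.
  by move: bij (psrc_le p); rewrite /band /plen pi pj; lia.
have /(ideal_short)/(_ pm) : quot_repr (proj f) - f \in J.
  by apply/(quot_projE (zero_relations_proper K n m_ge2)); exact: quot_reprK.
by rewrite !ffunE.
Qed.


Lemma quot_projP (a : Q) : exists f, a = proj f.
Proof. by exists (quot_repr a); rewrite quot_reprK. Qed.

Lemma pcoef_linear (c : K) f g i j :
  pcoef (c *: f + g) i j = c * pcoef f i j + pcoef g i j.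
Proof.
rewrite /pcoef mulr_sumr -big_split; apply: eq_bigr => p _.
by rewrite !ffunE.
Qed.

Lemma tcoef_linear (c : K) (a b : Q) i j :
  tcoef (c *: a + b) i j = c * tcoef a i j + tcoef b i j.
Proof.
have [f ->] := quot_projP a; have [g ->] := quot_projP b.
have -> : c *: proj f + proj g = proj (c *: f + g).
  by rewrite quot_projD -quot_projZ.
rewrite !tcoef_proj pcoef_linear; case: ifP => // _.
by rewrite mulr0 addr0.
Qed.

Lemma tcoef_inj (a b : Q) : (forall i j, tcoef a i j = tcoef b i j) -> a = b.
Proof.
have [f ->] := quot_projP a; have [g ->] := quot_projP b => E.
apply/quot_projE; apply: ideal_of_short => p pm; rewrite !ffunE.
have := E (psrc p) (ptgt p); rewrite !tcoef_proj !pcoef_path.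
have -> : band m (psrc p) (ptgt p).
  by move: pm (psrc_le p); rewrite /band /plen; lia.
by move=> ->; rewrite subrr.
Qed.

Lemma tcoef_out (a : Q) i j : ~~ band m i j -> tcoef a i j = 0.
Proof. by rewrite /tcoef => /negPf ->. Qed.

Lemma tcoef1 i j : tcoef 1 i j = (i == j)%:R.
Proof.
have -> : (1 : Q) = proj 1 by [].
rewrite tcoef_proj; case: ifPn => [/andP [ij _]|nb]; last first.
  by case: eqP nb => // ->; rewrite /band leqnn; lia.
by have [p <- <-] := lpath_ex ij; rewrite pcoef_path ffunE.
Qed.

Lemma tcoefM (a b : Q) i j : band m i j ->
  tcoef (a * b) i j = \sum_k tcoef a k j * tcoef b i k.
Proof.
have [f ->] := quot_projP a; have [g ->] := quot_projP b => bij.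
have -> : proj f * proj g = proj (f * g) by exact: quot_projM.
have out h k (l : vertex) : ~~ (k <= l)%N -> pcoef h k l = 0.
  move=> kl; rewrite /pcoef big1 // => p /andP [/eqP pk /eqP pl].
  by case/negP: kl; rewrite -pk -pl psrc_le.
rewrite tcoef_proj bij pcoefM; last by case/andP: bij.
apply: eq_bigr => k _; rewrite !tcoef_proj.
have [kj|/out ->] := boolP (k <= j)%N; last by rewrite if_same !mul0r.
have [ik|/out ->] := boolP (i <= k)%N; last by rewrite if_same !mulr0.
have -> : band m k j by move: bij; rewrite /band; lia.
by have -> : band m i k by move: bij; rewrite /band; lia.
Qed.

Lemma tcoef_tpath i j k l :
  tcoef (tpath i j) k l = [&& band m i j, k == i & l == j]%:R.
Proof.
have [bkl|nb] := boolP (band m k l); last first.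
  rewrite tcoef_out //; case: and3P => // -[bij /eqP ki /eqP lj].
  by move: nb; rewrite ki lj bij.
rewrite /tpath; case: ifP => _ /=; last first.
  have -> : (0 : Q) = proj 0 by rewrite quot_proj0.
  rewrite tcoef_proj bkl /pcoef big1 // => p _.
  by rewrite ffunE.
rewrite tcoef_proj bkl.
have /andP [/lpath_ex [p <- <-] _] := bkl.
by rewrite pcoef_path ffunE.
Qed.

Definition trunc_coords : band_coords Q n.-1.+1 m :=
  BandCoords tcoef_linear tcoef_inj tcoef_out tcoef1 tcoefM tcoef_tpath.

End TruncatedPathAlgebra.

(** The quiver has n.-1.+1 vertices, which is n as n > 0. *)
Lemma alg_dom_dim_trunc (K : fieldType) (n m : nat) (m_ge2 : (2 <= m)%N) :
  (m < n)%N ->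
  alg_dom_dim (truncPathAlg K n m_ge2) = Some (n %/ m + (n - m).+1 %/ m)%N.
Proof.
case: n => // n mn; apply: alg_dom_dimE.
exact: dom_dim_band (trunc_coords K n.+1 m_ge2) m_ge2 mn.
Qed.

Theorem proposition4p7 (K : fieldType) (n m : nat)
    (n_ge3 : (3 <= n)%N) (m_ge2 : (2 <= m)%N) (n_gem : (m + 1 <= n)%N) :
  (m = 2%N -> alg_dom_dim (truncPathAlg K n m_ge2) = Some (n - 1)%N) /\
  ((3 <= m)%N -> forall q j : nat, (1 <= q)%N -> (1 <= j <= m)%N ->
    n = (m * q + j)%N ->
    exists2 d : nat, alg_dom_dim (truncPathAlg K n m_ge2) = Some d &
      (d%:R : rat) =
        if (j <= m - 2)%N then (2 * n%:R - (m%:R + 2 * j%:R)) / m%:R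
        else if j == (m - 1)%N then (2 * n%:R - 2 * j%:R) / m%:R
        else (2 * n%:R - j%:R) / m%:R).
Proof.
rewrite alg_dom_dim_trunc; last by rewrite -addn1.
split=> [m2|m3 q j q1 jm nE].
  by congr Some; rewrite m2; lia.
exists (n %/ m + (n - m).+1 %/ m)%N => //.
have m0 : (m%:R : rat) != 0 by rewrite Num.Theory.pnatr_eq0; lia.
have div a r : (r < m)%N -> ((a * m + r) %/ m = a)%N.
  by move=> rm; rewrite divnMDl ?divn_small ?addn0 //; lia.
case: ifPn => jm2.
(* n - m + 1 = m (q - 1) + (j + 1), where j + 1 < m exactly in this case *)
- have -> : (n %/ m = q)%N by rewrite nE mulnC div //; lia.
  have -> : ((n - m).+1 %/ m = q.-1)%N.
    have -> : ((n - m).+1 = q.-1 * m + j.+1)%N.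
      by rewrite nE; case: q q1 {nE} => // q _; rewrite mulnS mulnC /=; lia.
    by rewrite div //; lia.
  rewrite nE; case: q q1 {nE} => // q _ /=; rewrite !natrD natrM -natr1; field.
  exact: m0.
- have qm : ((n - m).+1 = q * m + (j.+1 - m))%N.
    by rewrite nE mulnC; case: q q1 {nE} => // q _; rewrite mulSn; lia.
  have -> : ((n - m).+1 %/ m = q)%N by rewrite qm div //; lia.
  case: eqP => jE.
    have -> : (n %/ m = q)%N by rewrite nE mulnC div //; lia.
    by rewrite nE !natrD natrM; field.
  have {jE}jE : j = m by lia.
  have -> : (n %/ m = q.+1)%N by rewrite nE jE mulnC -mulSnr mulnK //; lia.
  by rewrite nE jE !natrD natrM -natr1; field.
Qed.
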